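(* If $H$ is a $3$-uniform hypergraph with $n_H$ vertices and $m_H$ edges, then $\tau_g(H) \le \frac{5}{16}(n_H + m_H)$.
   Context: A hypergraph $H=(V(H),E(H))$ is a finite set $V(H)$ of vertices together with a finite multiset $E(H)$ of nonempty subsets of $V(H)$, called edges; $n_H=|V(H)|$ and $m_H=|E(H)|$ (counted with multiplicity). $H$ is $k$-uniform if every edge has exactly $k$ vertices. A vertex hits an edge if it belongs to that edge; a transversal is a set of vertices having nonempty intersection with every edge. The transversal game on $H$ is played by two players, Edge-hitter and Staller, who take turns choosing a vertex of $H$; each chosen vertex must hit at least one edge not hit by the vertices previously chosen. The game ends when the set of chosen vertices is a transversal of $H$. Edge-hitter wishes to minimize, and Staller wishes to maximize, the total number of vertices chosen. The game transversal number $\tau_g(H)$ is the total number of vertices chosen when Edge-hitter moves first and both players play optimally. *)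

(* Defs.v *)
From mathcomp Require Import all_boot.
From mathcomp Require Import finmap multiset.

Set Implicit Arguments.
Unset Strict Implicit.
Unset Printing Implicit Defensive.

Local Open Scope mset_scope.

Record hypergraph := Hypergraph {
  vertex :> finType;
  edges : {mset {set vertex}};
  edge_nonempty : forall e : {set vertex}, e \in edges -> e != set0
}.

(* [size] of a multiset counts elements with multiplicity. *)
Definition num_vertices (H : hypergraph) : nat := #|vertex H|.
Definition num_edges (H : hypergraph) : nat := size (edges H).

Definition uniform (k : nat) (H : hypergraph) : Prop :=
  forall e : {set H}, e \in edges H -> #|e| = k.

Inductive player := EdgeHitter | Staller.

Section Game.

Variable H : hypergraph.
Implicit Types (S : {set H}) (v : H) (p : player).

Definition transversal S : bool :=
  all (fun e : {set H} => S :&: e != set0) (edges H).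

(* When the vertices of [S] have been chosen, [v] may be chosen next iff it
   hits an edge that no vertex of [S] hits. *)
Definition legal S v : bool :=
  has (fun e : {set H} => (v \in e) && (S :&: e == set0)) (edges H).

Definition opponent p : player :=
  if p is EdgeHitter then Staller else EdgeHitter.

(* Minimax value: the number of moves still to be made when [S] has been chosen
   and [p] is to move. The number [n] only serves to make the recursion
   structural. Starting from [n = #|~: S|] it never runs out, because a legal
   move is never in [S]; the default [#|H|] of the minimum is irrelevant,
   because it is an upper bound of the values and because a legal move exists
   unless [S] is a transversal. The lemmas below confirm this. *)
Fixpoint moves_left_rec (n : nat) p S : nat :=
  if transversal S then 0 else
  if n is n'.+1 then
    (match p with
     | EdgeHitter =>
         \big[minn/#|H|]_(v | legal S v) moves_left_rec n' Staller (v |: S)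
     | Staller =>
         \max_(v | legal S v) moves_left_rec n' EdgeHitter (v |: S)
     end).+1
  else 0.

Definition moves_left p S : nat := moves_left_rec #|~: S| p S.

Definition game_transversal_number : nat := moves_left EdgeHitter set0.

Lemma bigminn_le (P : pred H) (F : H -> nat) (x : nat) v :
  P v -> \big[minn/x]_(w | P w) F w <= F v.
Proof.
move=> Pv; have := mem_index_enum v.
elim: (index_enum _) => // w s IH; rewrite inE big_cons => /orP[/eqP<-|/IH le].
  by rewrite Pv geq_minl.
by case: ifP => // _; rewrite geq_min le orbT.
Qed.

Lemma legal_notin S v : legal S v -> v \notin S.
Proof.
case/hasP=> e _ /andP[ve /eqP Se]; apply/negP=> vS.
by have := in_set0 v; rewrite -Se inE vS ve.
Qed.

Lemma exists_legal S : ~~ transversal S -> exists v, legal S v.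
Proof.
rewrite -has_predC => /hasP[e eH /= Se].
have /set0Pn[v ve] := edge_nonempty eH.
by exists v; apply/hasP; exists e => //; rewrite ve -[_ == _]negbK.
Qed.

Lemma card_legal S v : legal S v -> #|~: S| = #|~: (v |: S)|.+1.
Proof.
move=> /legal_notin vS; rewrite (cardsD1 v) in_setC vS add1n; congr _.+1.
by apply: eq_card => w; rewrite !inE negb_or.
Qed.

Lemma moves_left_rec_le n p S : moves_left_rec n p S <= #|~: S|.
Proof.
elim: n p S => [|n IH] p S /=; case: ifP => // /negbT nT.
have [v lv] := exists_legal nT; case: p.
  rewrite (card_legal lv) ltnS; apply: leq_trans (IH Staller _).
  exact: bigminn_le.
rewrite (card_legal lv) ltnS; apply/bigmax_leqP => w lw.
by have := card_legal lw; rewrite (card_legal lv) => -[->]; apply: IH.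
Qed.

Lemma moves_left_end p S : transversal S -> moves_left p S = 0.
Proof. by rewrite /moves_left; case: #|_| => [|n] /= ->. Qed.

Lemma moves_left_EdgeHitter_le S v : legal S v ->
  moves_left EdgeHitter S <= (moves_left Staller (v |: S)).+1.
Proof.
move=> lv; rewrite /moves_left (card_legal lv) /=.
case: ifP => // _; rewrite ltnS.
exact: (bigminn_le (fun w => moves_left_rec #|~: (v |: S)| Staller (w |: S))).
Qed.

Lemma moves_left_EdgeHitter_attained S : ~~ transversal S ->
  exists2 v, legal S v &
    moves_left EdgeHitter S = (moves_left Staller (v |: S)).+1.
Proof.
move=> nT; have [v0 lv0] := exists_legal nT.
pose F v := moves_left_rec #|~: (v0 |: S)| Staller (v |: S).
case: (arg_minnP F lv0) => v lv vmin; exists v => //.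
rewrite /moves_left (card_legal lv0) /= (negbTE nT); congr _.+1.
have -> : #|~: (v |: S)| = #|~: (v0 |: S)|.
  by have := card_legal lv; rewrite (card_legal lv0) => -[].
apply/eqP; rewrite eqn_leq; apply/andP; split.
  exact: bigminn_le.
elim/big_ind: _ => [|x y|]; last exact: vmin.
  by apply: leq_trans (moves_left_rec_le _ _ _) _; apply: max_card.
by rewrite leq_min => -> ->.
Qed.

Lemma moves_left_Staller_ge S v : legal S v ->
  (moves_left EdgeHitter (v |: S)).+1 <= moves_left Staller S.
Proof.
move=> lv; have /negbTE nT : ~~ transversal S.
  have /hasP[e eH /andP[_ Se]] := lv.
  by rewrite -has_predC; apply/hasP; exists e => //=; rewrite negbK.
rewrite /moves_left (card_legal lv) /= nT ltnS.
exact: (@leq_bigmax_cond _ (legal S)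
  (fun w => moves_left_rec #|~: (v |: S)| EdgeHitter (w |: S)) v lv).
Qed.

Lemma moves_left_Staller_attained S : ~~ transversal S ->
  exists2 v, legal S v &
    moves_left Staller S = (moves_left EdgeHitter (v |: S)).+1.
Proof.
move=> nT; have [v0 lv0] := exists_legal nT.
have [|v lv E] := @eq_bigmax_cond _ [pred v | legal S v]
    (fun v => moves_left_rec #|~: (v0 |: S)| EdgeHitter (v |: S)).
  by apply/card_gt0P; exists v0.
exists v => //; rewrite /moves_left (card_legal lv0) /= (negbTE nT).
congr _.+1; have := card_legal lv; rewrite (card_legal lv0) => -[<-].
exact: E.
Qed.

End Game.

(* Main.v *)
Require Import Defs.
From mathcomp Require Import all_boot all_order all_algebra.
From mathcomp Require Import finmap multiset zify.

Import Order.TTheory GRing.Theory Num.Theory.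

Set Implicit Arguments.
Unset Strict Implicit.
Unset Printing Implicit Defensive.

(** Edge-hitter plays greedily against a potential.  Give a vertex lying in [d]
    edges not yet hit the weight 0, 16, 24 for [d = 0, 1, 2] and [15 + 5 d] for
    [d >= 3], and let the potential of a position be the sum of the weights.
    Since the degrees of a 3-uniform hypergraph add up to [3 m], the potential
    is initially at most [15 n + 15 m]; so it suffices that with Edge-hitter to
    move the rest of the game takes at most 1/48 of the potential
    ([moves_left_le]).  By induction this holds if Edge-hitter has a move such
    that he and Staller together remove 96 from the potential, or less when
    divisibility makes up for it ([good_move_exists]); if his move ends the
    game, the 48 carried by any remaining edge are enough ([potential_ge48]).

    The weights are concave in the degree.  Write [slope k] for the loss in
    weight when a degree falls from [k] to [k - 1].  If all degrees are at most
    [k], then choosing a vertex of degree [j] removes its own weight and at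
    least [slope k] for each of the [2 j] incidences of its edges with other
    vertices ([potential_del_max]).  Let Edge-hitter choose a vertex of maximum
    degree [k].
    - For [k >= 4] he removes at least 75 and Staller at least 26.
    - For [k = 3] the sum is only 66 + 28.  He gains the missing 2 if some
      vertex of degree 3 has a neighbour of smaller degree or shares two edges
      with a neighbour.  Otherwise the vertices of degree 3 form 3-regular
      components without such coincidences, and there Staller cannot find a
      vertex of degree 1 whose edge has two vertices of degree 3
      ([good_move3]).
    - For [k = 2] the sum is 56 + 32.  He gains the missing 8 if some vertex of
      degree 2 has a neighbour of degree 1.  Otherwise the vertices of degree 1
      form isolated edges, and the potential is divisible by 24.  As 48 times
      the length of the game is a multiple of 48, removing 88 from a multiple
      of 24 is as good as removing 96 ([good_move2]).
    - For [k = 1] the edges are disjoint, and each move removes 48. *)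

(** * The weight of a degree *)

(** The line [15 + 5 d] is three times the share [5 + 5 d / 3] of a vertex of
    degree [d] in [5 (n + m)].  The value 16 at 1 makes an isolated edge worth
    exactly one move.  The value 24 at 2 balances two needs: a larger weight
    makes Edge-hitter's moves too cheap when the maximum degree is 3, and a
    smaller one when it is 2. *)
Definition weight (d : nat) : nat :=
  match d with 0 => 0 | 1 => 16 | 2 => 24 | _ => 15 + 5 * d end.

Definition slope (k : nat) : nat := weight k - weight k.-1.

Lemma weight_le d : weight d <= 15 + 5 * d.
Proof. by case: d => [|[|[|d]]]. Qed.

Lemma slopeE k : 0 < k ->
  slope k = match k with 1 => 16 | 2 => 8 | 3 => 6 | _ => 5 end.
Proof. case: k => [|[|[|[|k]]]] //= _; rewrite /slope /=; lia. Qed.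

(** Concavity: every unit of degree lost below level [k] costs at least the
    last one. *)
Lemma weight_slope k c d : c + d <= k ->
  slope k * c + weight d <= weight (c + d).
Proof.
case: (posnP c) => [->|c0 le_k]; first by rewrite muln0.
rewrite slopeE; last by lia.
have weightE n : 2 < n -> weight n = 15 + 5 * n by case: n => [|[|[|n]]].
have [n3|] := ltnP 2 (c + d); last first.
  by move: c0 le_k; case: d c k => [|[|[|d]]] [|[|[|c]]] [|[|[|[|k]]]].
rewrite (weightE _ n3).
case: d le_k n3 => [|[|[|d]]]; case: k => [|[|[|[|k]]]] /=; lia.
Qed.

(** The bound of [weight_slope] at level 3 improves as soon as the loss reaches
    below the step from 3 to 2, because the next step costs 8 rather than 6. *)
Lemma weight_surplus3 c d : 0 < c -> c + d <= 3 -> (c + d < 3) || (1 < c) ->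
  slope 3 * c + 2 + weight d <= weight (c + d).
Proof. by case: c d => [|[|[|[|c]]]] [|[|[|d]]]. Qed.

(** * Degrees and the potential of a sequence of edges *)

Section EdgeSequences.

Variable T : finType.
Implicit Types (L : seq {set T}) (u v w : T) (e : {set T}).

(** The edges of a position are kept as a sequence, so that repeated edges
    count with multiplicity.  The number of edges containing both [v] and [u]
    is [deg (star L v) u]. *)
Definition deg L v : nat := count (fun e : {set T} => v \in e) L.
Definition star L v : seq {set T} := [seq e : {set T} <- L | v \in e].
Definition del L v : seq {set T} := [seq e : {set T} <- L | v \notin e].
Definition potential L : nat := \sum_v weight (deg L v).

Definition uniform3 L : bool := all (fun e : {set T} => #|e| == 3) L.

Lemma uniform3_filter (P : pred {set T}) L :
  uniform3 L -> uniform3 (filter P L).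
Proof. by move=> /allP U; apply/allP=> e; rewrite mem_filter => /andP[_ /U]. Qed.

Lemma deg_star_del L v u : deg L u = deg (star L v) u + deg (del L v) u.
Proof.
rewrite /deg !count_filter; elim: L => //= e L ->.
by case: (v \in e); case: (u \in e) => /=; lia.
Qed.

Lemma deg_gt0 L v : reflect (exists2 e : {set T}, e \in L & v \in e) (0 < deg L v).
Proof. by rewrite -has_count; apply: hasP. Qed.

Lemma deg_star_self L v : deg (star L v) v = deg L v.
Proof.
by rewrite /deg count_filter; apply: eq_count => e /=; rewrite andbb.
Qed.

Lemma deg_del_self L v : deg (del L v) v = 0.
Proof. by have := deg_star_del L v v; rewrite deg_star_self; lia. Qed.

Lemma codeg_gt0 L v u e : e \in L -> v \in e -> u \in e -> 0 < deg (star L v) u.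
Proof. by move=> eL ve ue; apply/deg_gt0; exists e; rewrite ?mem_filter ?ve. Qed.

Lemma sum_deg L (f : T -> nat) :
  \sum_v deg L v * f v = \sum_(e <- L) \sum_(v in e) f v.
Proof.
elim: L => [|e L IH]; first by rewrite big_nil big1.
rewrite big_cons -IH [X in _ = X + _]big_mkcond -big_split /=.
by apply: eq_bigr => v _; rewrite mulnDl; case: (v \in e); rewrite ?mul1n.
Qed.

Lemma sum_deg3 L : uniform3 L -> \sum_v deg L v = 3 * size L.
Proof.
move=> U; transitivity (\sum_v deg L v * 1).
  by apply: eq_bigr => v _; rewrite muln1.
rewrite sum_deg; elim: L U => [|e L IH] /=; first by rewrite big_nil.
by case/andP=> /eqP e3 /IH {}IH; rewrite big_cons IH sum1_card e3 mulnS.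
Qed.

Lemma sum_codeg L v : uniform3 L ->
  \sum_(u | u != v) deg (star L v) u = 2 * deg L v.
Proof.
move=> U; have := sum_deg3 (uniform3_filter (fun e : {set T} => v \in e) U).
rewrite (bigD1 v) //= -/(star L v) deg_star_self size_filter -/(deg L v); lia.
Qed.

(** Each vertex [u != v] loses [deg (star L v) u] from its degree, and these
    losses sum to [2 * deg L v] because each edge at [v] has two other vertices.
    The function [x] collects what a vertex loses beyond the slope bound. *)
Lemma potential_del L k v (x : T -> nat) : uniform3 L ->
    (forall u, deg L u <= k) ->
    (forall u, u != v -> slope k * deg (star L v) u + x u + weight (deg (del L v) u)
                          <= weight (deg L u)) ->
  potential (del L v) + weight (deg L v) + 2 * slope k * deg L v
    + \sum_(u | u != v) x u
    <= potential L.
Proof.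
move=> U degk drop; rewrite /potential (bigD1 v) //= deg_del_self add0n.
rewrite [leqRHS](bigD1 v) //= (mulnC 2) -mulnA -sum_codeg // big_distrr /=.
rewrite [X in X + _ + _]addnC -!addnA leq_add2l addnC -addnA -!big_split /=.
by apply: leq_sum => u uv; have := drop u uv; lia.
Qed.

Lemma potential_del_max L k v : uniform3 L -> (forall u, deg L u <= k) ->
  potential (del L v) + weight (deg L v) + 2 * slope k * deg L v <= potential L.
Proof.
move=> U degk; have := @potential_del L k v (fun=> 0) U degk.
rewrite big1 // addn0; apply=> u _; rewrite addn0 (deg_star_del L v u).
by apply: weight_slope; rewrite -deg_star_del.
Qed.

Lemma potential_del_surplus L k v w x : uniform3 L -> (forall u, deg L u <= k) ->
    w != v ->
    slope k * deg (star L v) w + x + weight (deg (del L v) w) <= weight (deg L w) ->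
  potential (del L v) + weight (deg L v) + 2 * slope k * deg L v + x <= potential L.
Proof.
move=> U degk wv dropw.
have := @potential_del L k v (fun u => if u == w then x else 0) U degk.
rewrite -big_mkcondr (big_pred1 w) => [|u /=]; last first.
  by case: (eqVneq u w) => [->|]; rewrite ?wv ?andbF.
apply=> u _; case: eqP => [-> //|_]; rewrite addn0 (deg_star_del L v u).
by apply: weight_slope; rewrite -deg_star_del.
Qed.

Lemma deg_del_le L v u : deg (del L v) u <= deg L u.
Proof. by rewrite (deg_star_del L v u) leq_addl. Qed.

Lemma uniform3_del L v : uniform3 L -> uniform3 (del L v).
Proof. exact: uniform3_filter. Qed.

(** The least that Staller can remove: the worst case is a vertex of degree 1
    in an edge with two vertices of degree [k]. *)
Lemma potential_del_ge L k u : uniform3 L -> (forall u, deg L u <= k) ->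
  0 < deg L u -> potential (del L u) + 16 + 2 * slope k <= potential L.
Proof.
move=> U degk du; apply: leq_trans (potential_del_max u U degk).
have : 16 <= weight (deg L u) by case: (deg L u) du => [|[|[|d]]] //= _; lia.
have : 2 * slope k <= 2 * slope k * deg L u by rewrite leq_pmulr.
lia.
Qed.

Lemma exists_other_vertex e u : #|e| = 3 -> exists2 w, w \in e & w != u.
Proof.
move=> e3; have : 0 < #|e :\ u|.
  by have := cardsD1 u e; rewrite e3; case: (u \in e); lia.
by case/card_gt0P=> w; rewrite !inE => /andP[wu we]; exists w.
Qed.

(** * Good moves for Edge-hitter *)

(** This is the inductive step that Edge-hitter's choice of [v] must support.
    It does not require a drop of 96 in the potential, because for maximum
    degree 2 the integrality of [t] has to be used. *)
Definition good_move L v : Prop :=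
  forall u t, 0 < deg (del L v) u ->
    48 * t <= potential (del (del L v) u) -> 48 * (t + 2) <= potential L.

Lemma good_move_ge4 L v : uniform3 L -> (forall u, deg L u <= deg L v) ->
  4 <= deg L v -> good_move L v.
Proof.
move=> U degk v4 u t du ht; have U' := uniform3_del v U.
have degk' w : deg (del L v) w <= deg L v := leq_trans (deg_del_le L v w) (degk w).
have := potential_del_max v U degk; have := potential_del_ge U' degk' du.
rewrite slopeE; last by lia.
by case: (deg L v) v4 => [|[|[|[|k]]]] //= _; lia.
Qed.

(** If no neighbour gives Edge-hitter a surplus, every neighbour of a vertex of
    degree 3 has degree 3 and shares one edge with it.  Suppose Staller answers
    [v0] with a vertex [u] of degree 1 whose edge has two other vertices still
    of degree 3.  Then [u] had degree 3 as a neighbour of those, so it lost two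
    edges to [v0], with which it shares only one. *)
Lemma good_move3 L : uniform3 L -> (forall u, deg L u <= 3) ->
  (exists v, deg L v = 3) -> exists2 v, deg L v = 3 & good_move L v.
Proof.
move=> U deg3 [v0 v0_3].
(* A neighbour [w] of [v] that loses 2 more than the slope bound. *)
pose ok v w := [&& w != v, deg L v == 3, 0 < deg (star L v) w
                 & (deg L w < 3) || (1 < deg (star L v) w)].
have [/existsP[v /existsP[w /and4P[wv /eqP v3 vw okw]]]|] :=
    boolP [exists v, [exists w, ok v w]].
  exists v => // u t du ht; have U' := uniform3_del v U.
  have deg3' x : deg (del L v) x <= 3 := leq_trans (deg_del_le L v x) (deg3 x).
  have := potential_del_ge U' deg3' du.
  have : slope 3 * deg (star L v) w + 2 + weight (deg (del L v) w) <= weight (deg L w).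
    by rewrite (deg_star_del L v w) weight_surplus3 -?deg_star_del.
  move/(potential_del_surplus U deg3 wv); rewrite v3 slopeE //=; lia.
move=> /existsPn none.
have regular v w : w != v -> deg L v = 3 -> 0 < deg (star L v) w ->
    deg L w = 3 /\ deg (star L v) w = 1.
  move=> wv v3 vw; have /existsPn/(_ w) := none v.
  rewrite /ok wv v3 vw eqxx /= negb_or -!leqNgt; have := deg3 w; lia.
exists v0 => // u t du ht; have U' := uniform3_del v0 U.
have deg3' x : deg (del L v0) x <= 3 := leq_trans (deg_del_le L v0 x) (deg3 x).
have := potential_del_max v0 U deg3; rewrite v0_3 slopeE //=.
(* A vertex of degree at least 2 costs Staller at least 24 + 4 * 6. *)
have [u2|u1] := ltnP 1 (deg (del L v0) u).
  have := potential_del_max u U' deg3'; rewrite slopeE //.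
  have : 24 <= weight (deg (del L v0) u).
    by case: (deg (del L v0) u) u2 => [|[|[|d]]] //= _; lia.
  lia.
have {}u1 : deg (del L v0) u = 1 by lia.
have /deg_gt0[e eL ue] := du.
have e3 : #|e| = 3 by have /allP/(_ e eL)/eqP := U'.
have [x xe xu] := exists_other_vertex u e3.
have x_u : 0 < deg (star (del L v0) u) x by apply: codeg_gt0 eL ue xe.
have x2 : deg (del L v0) x < 3.
  rewrite ltn_neqAle deg3' andbT; apply/eqP=> x3'.
  have x3 : deg L x = 3 by have := deg3 x; have := deg_del_le L v0 x; lia.
  have eL0 : e \in L by move: eL; rewrite mem_filter => /andP[].
  have [|u3 _] := regular x u _ x3 (codeg_gt0 eL0 xe ue); first by rewrite eq_sym.
  have uv0 : u != v0 by apply: contraTneq du => ->; rewrite deg_del_self.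
  have := deg_star_del L v0 u; rewrite u3 u1 => cu.
  by have [|_] := regular v0 u uv0 v0_3; lia.
have : slope 3 * deg (star (del L v0) u) x + 2 + weight (deg (del (del L v0) u) x)
    <= weight (deg (del L v0) x).
  by rewrite (deg_star_del (del L v0) u x) weight_surplus3 -?deg_star_del ?x2.
by move/(potential_del_surplus U' deg3' xu); rewrite u1 slopeE //=; lia.
Qed.

(** Vertices of degree 2 weigh 24.  If no edge joins them to vertices of degree
    1, then the latter come in triples, the isolated edges, and 3 * 16 is
    again a multiple of 24. *)
Lemma potential_dvd24 L : uniform3 L -> (forall u, deg L u <= 2) ->
    (forall e : {set T}, e \in L -> {in e &, forall v w, deg L v = 2 -> deg L w = 2}) ->
  24 %| potential L.
Proof.
move=> U deg2 same.
have -> : potential L = \sum_v 24 * (deg L v == 2)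
                        + \sum_v deg L v * (16 * (deg L v == 1)).
  rewrite -big_split /=; apply: eq_bigr => v _.
  by case: (deg L v) (deg2 v) => [|[|[|d]]].
rewrite dvdn_add //; first by apply: dvdn_sum => v _; apply: dvdn_mulr.
rewrite sum_deg big_seq; apply: dvdn_sum => e eL.
have e3 : #|e| = 3 by have /allP/(_ e eL)/eqP := U.
have pos v : v \in e -> 0 < deg L v by move=> ve; apply/deg_gt0; exists e.
have [/exists_inP[v ve /eqP v2]|none] := boolP [exists v in e, deg L v == 2].
  by rewrite big1 // => w we; rewrite (same e eL v w ve we v2).
rewrite (eq_bigr (fun=> 16)) ?sum_nat_const ?e3 // => v ve.
have /exists_inPn/(_ v ve) := none.
by have := pos v ve; have := deg2 v; case: (deg L v) => [|[|[|d]]].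
Qed.

(** Without a neighbour giving a surplus of 8, the two moves may remove only 88;
    divisibility by 24 then replaces the missing 8. *)
Lemma good_move2 L : uniform3 L -> (forall u, deg L u <= 2) ->
  (exists v, deg L v = 2) -> exists2 v, deg L v = 2 & good_move L v.
Proof.
move=> U deg2 [v0 v0_2].
pose ok v w := [&& deg L v == 2, 0 < deg (star L v) w & deg L w == 1].
have [/existsP[v /existsP[w /and3P[/eqP v2 vw /eqP w1]]]|] :=
    boolP [exists v, [exists w, ok v w]].
  exists v => // u t du ht; have U' := uniform3_del v U.
  have deg2' x : deg (del L v) x <= 2 := leq_trans (deg_del_le L v x) (deg2 x).
  have := potential_del_ge U' deg2' du.
  have wv : w != v by apply/eqP=> wv; rewrite wv v2 in w1.
  have : slope 2 * deg (star L v) w + 8 + weight (deg (del L v) w) <= weight (deg L w).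
    have := deg_star_del L v w; rewrite w1; move: vw.
    by case: (deg (star L v) w) (deg (del L v) w) => [|[|c]] [|d].
  by move/(potential_del_surplus U deg2 wv); rewrite v2 slopeE //=; lia.
move=> /existsPn none; exists v0 => // u t du ht; have U' := uniform3_del v0 U.
have deg2' x : deg (del L v0) x <= 2 := leq_trans (deg_del_le L v0 x) (deg2 x).
have := potential_del_ge U' deg2' du.
have := potential_del_max v0 U deg2; rewrite v0_2 slopeE //=.
(* From [48 * t <= 24 * q - 88] follows [2 * t <= q - 4], as [2 * t] is an
   integer. *)
suff /dvdnP[q ->] : 24 %| potential L by lia.
apply: potential_dvd24 => // e eL v w ve we v2.
have /existsPn/(_ w) := none v; rewrite /ok v2 eqxx (codeg_gt0 eL ve we) /=.
have : 0 < deg L w by apply/deg_gt0; exists e.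
by have := deg2 w; lia.
Qed.

Lemma good_move1 L v : uniform3 L -> (forall u, deg L u <= 1) ->
  deg L v = 1 -> good_move L v.
Proof.
move=> U deg1 v1 u t du ht; have U' := uniform3_del v U.
have deg1' x : deg (del L v) x <= 1 := leq_trans (deg_del_le L v x) (deg1 x).
have := potential_del_ge U' deg1' du.
by have := potential_del_max v U deg1; rewrite v1 slopeE //=; lia.
Qed.

Lemma good_move_exists L : uniform3 L -> L != [::] ->
  exists2 v, 0 < deg L v & good_move L v.
Proof.
move=> U L0; have [e eL] : exists e : {set T}, e \in L.
  by case: L L0 {U} => // e L _; exists e; rewrite mem_head.
have e3 : #|e| = 3 by have /allP/(_ e eL)/eqP := U.
have /card_gt0P[w we] : 0 < #|e| by rewrite e3.
have [v _ vmax] := arg_maxnP (deg L) (erefl (xpredT w)).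
have {}vmax u : deg L u <= deg L v := vmax u isT.
have v0 : 0 < deg L v by apply: leq_trans (vmax w); apply/deg_gt0; exists e.
have [v4|] := ltnP 3 (deg L v); first by exists v => //; apply: good_move_ge4.
case E: (deg L v) => [|[|[|[|k]]]] // _; rewrite E in vmax v0 => //.
- by exists v; rewrite ?E //; apply: good_move1.
- by have [|x x2 gx] := good_move2 U vmax; [exists v|exists x; rewrite ?x2].
- by have [|x x2 gx] := good_move3 U vmax; [exists v|exists x; rewrite ?x2].
Qed.

Lemma potential_ge48 L : uniform3 L -> L != [::] -> 48 <= potential L.
Proof.
move=> U; case: L U => // e L /= /andP[/eqP e3 _] _.
rewrite /potential (bigID (mem e)) /=.
apply: leq_trans (leq_addr _ _); rewrite -[48]/(3 * 16) -e3 -sum_nat_const.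
apply: leq_sum => v ve; rewrite /deg /= ve add1n.
by case: (count _ _) => [|[|d]] //=; lia.
Qed.

Lemma potential_le L : uniform3 L -> potential L <= 15 * (#|T| + size L).
Proof.
move=> U; apply: leq_trans (_ : \sum_v (15 + 5 * deg L v) <= _).
  by apply: leq_sum => v _; apply: weight_le.
rewrite big_split /= -big_distrr /= sum_deg3 // sum_nat_const mulnDr.
by rewrite leq_add ?mulnA // mulnC.
Qed.

End EdgeSequences.

(** * The game *)

Section Game.

Variable H : hypergraph.
Implicit Types (S : {set H}) (v u : H).

Definition live S : seq {set H} := [seq e : {set H} <- edges H | S :&: e == set0].

Lemma uniform3_live S : uniform 3 H -> uniform3 (live S).
Proof.
by move=> H3; apply/allP=> e; rewrite mem_filter => /andP[_ eH]; apply/eqP/H3.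
Qed.

Lemma live0 : live set0 = edges H.
Proof.
by rewrite /live (@eq_filter _ _ predT) ?filter_predT // => e; rewrite /= set0I eqxx.
Qed.

Lemma transversal_live S : Defs.transversal S = (live S == [::]).
Proof.
rewrite /Defs.transversal /live -[_ == [::]]negbK -[in RHS]/(nilp _) -has_filter.
by rewrite -all_predC; apply: eq_all => e.
Qed.

Lemma live_del S v : live (v |: S) = del (live S) v.
Proof.
rewrite /live /del -filter_predI; apply: eq_filter => e /=.
by rewrite setIUl setU_eq0 setI_eq0 disjoints1.
Qed.

Lemma legal_deg S v : legal S v = (0 < deg (live S) v).
Proof.
by rewrite /legal /deg count_filter -has_count; apply: eq_has => e.
Qed.

Lemma moves_left_le S : uniform 3 H ->
  48 * moves_left EdgeHitter S <= potential (live S).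
Proof.
move=> H3; have [n le_n] := ubnP #|~: S|.
elim: n S le_n => // n IH S; rewrite ltnS => le_n.
have [/moves_left_end-> //|nT] := boolP (Defs.transversal S).
have U := uniform3_live S H3.
have L0 : live S != [::] by rewrite -transversal_live.
have [v dv good] := good_move_exists U L0.
have lv : legal S v by rewrite legal_deg.
have := moves_left_EdgeHitter_le lv.
have [/moves_left_end->|nTv] := boolP (Defs.transversal (v |: S)).
  by have := potential_ge48 U L0; lia.
have [u lu ->] := moves_left_Staller_attained nTv => le_t.
have /IH : #|~: (u |: (v |: S))| < n.
  by apply: leq_trans le_n; rewrite (card_legal lv) (card_legal lu).
rewrite !live_del => /good; rewrite -live_del -legal_deg => /(_ lu); lia.
Qed.

End Game.

Local Open Scope ring_scope.

Theorem theorem5 (H : hypergraph) (hH : uniform 3 H) :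
  (game_transversal_number H)%:R
    <= 5%:R / 16%:R * (num_vertices H + num_edges H)%:R :> rat.
Proof.
have le_pot := leq_trans (moves_left_le set0 hH) (potential_le (uniform3_live set0 hH)).
have le15 : (16 * game_transversal_number H <= 5 * (num_vertices H + num_edges H))%N.
  by rewrite live0 in le_pot; rewrite -(@leq_pmul2l 3) // !mulnA.
rewrite mulrAC ler_pdivlMr ?ltr0n // -!natrM ler_nat mulnC.
exact: le15.
Qed.
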